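(* Let $K$ be a locally finite simplicial complex that is a CAT(0) space when endowed with the standard piecewise Euclidean metric. Then $K$ has an arborescent structure: there is a sequence of finite subcomplexes $L_1\subseteq L_2\subseteq \cdots$ of $K$, each of which is collapsible, such that $K=\bigcup_{n=1}^{\infty} L_n$.
   Context: All simplicial complexes are finite dimensional. $K$ is locally finite if every point of $|K|$ has a neighborhood meeting only finitely many simplices of $K$. The standard piecewise Euclidean metric on $|K|$ is obtained by making each simplex isometric to a regular Euclidean simplex of the same dimension with all edge lengths $1$, and defining the distance between two points as the infimum of lengths of paths in $|K|$ joining them. A geodesic metric space $X$ is CAT(0) if for every geodesic triangle $\Delta(p,q,r)$ in $X$ with Euclidean comparison triangle $\bar\Delta$ (same side lengths) in $\mathbb{R}^2$, and all points $x,y\in\Delta$ with comparison points $\bar x,\bar y\in\bar\Delta$, one has $d(x,y)\le d_{\mathbb{R}^2}(\bar x,\bar y)$. A simplex is free if it is a proper face of exactly one simplex of the complex; an elementary collapse deletes a free face $\sigma$ together with the unique simplex containing it. A finite complex is collapsible if it can be reduced to a single vertex by a finite sequence of elementary collapses. *)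

(* Defs.v *)
From Stdlib Require Import Reals List.
Open Scope R_scope.
Set Implicit Arguments.

Section Cx.
Variable V : Type.

Definition vset := V -> Prop.
Definition complex := vset -> Prop.

Definition same (s t : vset) : Prop := forall v, s v <-> t v.
Definition finite_vset (s : vset) : Prop := exists l : list V, forall v, s v <-> In v l.
Definition face (s t : vset) : Prop := forall v, s v -> t v.
Definition proper_face (s t : vset) : Prop := face s t /\ exists v, t v /\ ~ s v.

Definition is_complex (K : complex) : Prop :=
  (forall s, K s -> finite_vset s /\ exists v, s v) /\
  (forall s t, K s -> same s t -> K t) /\
  (forall s t, K s -> face t s -> (exists v, t v) -> K t) /\
  (exists n : nat, forall s, K s -> forall l : list V, NoDup l ->
       (forall w, In w l -> s w) -> (length l <= n)%nat).

Definition subcomplex (L K : complex) : Prop :=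
  is_complex L /\ forall s, L s -> K s.

Definition finite_complex (L : complex) : Prop :=
  exists ls : list (list V), forall s, L s <-> exists l, In l ls /\ same s (fun w => In w l).

Definition locally_finite (K : complex) : Prop :=
  forall v, K (fun w => w = v) ->
    exists ls : list (list V), forall s, K s -> s v ->
      exists l, In l ls /\ same s (fun w => In w l).

(* Points of |K|: barycentric coordinates *)
Definition is_point (K : complex) (x : V -> R) : Prop :=
  (forall v, 0 <= x v) /\
  K (fun v => x v <> 0) /\
  exists l : list V, NoDup l /\ (forall v, x v <> 0 <-> In v l) /\
    fold_right Rplus 0 (map x l) = 1.

Definition in_common_simplex (K : complex) (x y : V -> R) : Prop :=
  exists s, K s /\ forall v, x v <> 0 \/ y v <> 0 -> s v.

(* distance inside a simplex, each simplex regular Euclidean with edge length 1 *)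
Definition simplex_dist (x y : V -> R) (r : R) : Prop :=
  exists l : list V, NoDup l /\ (forall v, x v <> 0 \/ y v <> 0 -> In v l) /\
    r = sqrt (fold_right Rplus 0 (map (fun v => (x v - y v) ^ 2) l) / 2).

Inductive chain (K : complex) : (V -> R) -> (V -> R) -> R -> Prop :=
| chain_nil x : is_point K x -> chain K x x 0
| chain_cons x y z r s : is_point K x -> in_common_simplex K x y ->
    simplex_dist x y r -> chain K y z s -> chain K x z (r + s).

Definition is_inf (E : R -> Prop) (m : R) : Prop :=
  (forall r, E r -> m <= r) /\ (forall m', (forall r, E r -> m' <= r) -> m' <= m).

Definition std_metric (K : complex) (d : (V -> R) -> (V -> R) -> R) : Prop :=
  forall x y, is_point K x -> is_point K y -> is_inf (chain K x y) (d x y).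

Definition geodesic (K : complex) (d : (V -> R) -> (V -> R) -> R)
  (c : R -> V -> R) (p q : V -> R) : Prop :=
  c 0 = p /\ c (d p q) = q /\
  forall s t, 0 <= s <= d p q -> 0 <= t <= d p q ->
    is_point K (c s) /\ d (c s) (c t) = Rabs (s - t).

Definition geodesic_space (K : complex) d : Prop :=
  forall p q, is_point K p -> is_point K q -> exists c, geodesic K d c p q.

Definition dist2 (a b : R * R) : R :=
  sqrt ((fst a - fst b) ^ 2 + (snd a - snd b) ^ 2).

Definition on_side (c : R -> V -> R) (L : R) (a b : R * R) (x : V -> R) (xb : R * R) :=
  exists t, 0 <= t <= L /\ x = c t /\
    xb = (fst a + t / L * (fst b - fst a), snd a + t / L * (snd b - snd a)).

Definition CAT0 (K : complex) (d : (V -> R) -> (V -> R) -> R) : Prop :=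
  forall p q r c1 c2 c3 (pb qb rb : R * R),
    is_point K p -> is_point K q -> is_point K r ->
    geodesic K d c1 p q -> geodesic K d c2 q r -> geodesic K d c3 r p ->
    dist2 pb qb = d p q -> dist2 qb rb = d q r -> dist2 rb pb = d r p ->
    forall x xb y yb,
      (on_side c1 (d p q) pb qb x xb \/ on_side c2 (d q r) qb rb x xb \/
       on_side c3 (d r p) rb pb x xb) ->
      (on_side c1 (d p q) pb qb y yb \/ on_side c2 (d q r) qb rb y yb \/
       on_side c3 (d r p) rb pb y yb) ->
      d x y <= dist2 xb yb.

Definition is_CAT0_complex (K : complex) : Prop :=
  exists d, std_metric K d /\ geodesic_space K d /\ CAT0 K d.

Inductive collapsible : complex -> Prop :=
| coll_vertex (L : complex) (v : V) :
    (forall s, L s <-> same s (fun w => w = v)) -> collapsible L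
| coll_step (L L' : complex) (s t : vset) :
    L s -> L t -> proper_face s t ->
    (forall r, L r -> proper_face s r -> same r t) ->
    (forall r, L' r <-> (L r /\ ~ same r s /\ ~ same r t)) ->
    collapsible L' -> collapsible L.

End Cx.

(* Main.v *)
(* Fix a vertex [v0] and, for every vertex [v], the closed ball [B v] of radius
   [1 / sqrt 2] around it.  The radius lies between the circumradii and the
   heights of all regular simplices of edge 1, so the balls [B v], [v] in [s],
   have a common point exactly when [s] is a simplex, and every point is strictly
   inside some [B v].  By the CAT(0) condition the balls are convex, so the
   intersection of the [B v], [v] in [s], has a unique point [m s] nearest to [v0].
   Let [c s] be a vertex having [m s] strictly inside its ball, chosen as a function
   of [m s].  Adding [c s] to [s], or removing it from [s], does not change [m s];
   so toggling [c s] is a matching of all simplices other than [{v0}].  The distance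
   from [v0] to [m s] is constant on matched pairs and monotone in [s], hence its
   sublevel sets are finite subcomplexes, which collapse along the matching to [v0]. *)
Require Import Defs.
From Stdlib Require Import Reals List Lra Lia.
From Stdlib Require Import Classical ClassicalEpsilon FunctionalExtensionality PropExtensionality.
Set Implicit Arguments.

(** [V] is an arbitrary type; this classical decision serves [nodup], [remove] and [vertex], and
    later also compares whole vertex sets. *)
Definition eq_dec_cl (A : Type) (x y : A) : {x = y} + {x <> y} :=
  excluded_middle_informative (x = y).

Lemma same_eq (V : Type) (s t : vset V) : same s t -> s = t.
Proof.
  intro H. apply functional_extensionality; intro v.
  apply propositional_extensionality, H.
Qed.

(** * Finite sums and the Euclidean distance in barycentric coordinates *)

Definition lsum (A : Type) (f : A -> R) (l : list A) : R := fold_right Rplus 0 (map f l).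

Lemma lsum_nonneg (A : Type) (f : A -> R) (l : list A) :
  (forall v, 0 <= f v) -> 0 <= lsum f l.
Proof.
  intro Hf. induction l as [|a l IH]; unfold lsum in *; simpl; [lra|].
  specialize (Hf a); lra.
Qed.

Lemma lsum_le (A : Type) (f g : A -> R) (l : list A) :
  (forall v, In v l -> f v <= g v) -> lsum f l <= lsum g l.
Proof.
  induction l as [|a l IH]; intro H; unfold lsum in *; simpl; [lra|].
  assert (f a <= g a) by (apply H; left; reflexivity).
  assert (fold_right Rplus 0 (map f l) <= fold_right Rplus 0 (map g l))
    by (apply IH; intros; apply H; right; assumption).
  lra.
Qed.

Lemma lsum_const (A : Type) (c : R) (l : list A) :
  lsum (fun _ => c) l = INR (length l) * c.
Proof.
  induction l as [|a l IH]; unfold lsum in *.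
  - simpl; ring.
  - simpl length. rewrite S_INR. simpl. rewrite IH. ring.
Qed.

Lemma lsum_scal (A : Type) (c : R) (f : A -> R) (l : list A) :
  lsum (fun v => c * f v) l = c * lsum f l.
Proof.
  induction l as [|a l IH]; unfold lsum in *; simpl; [ring|rewrite IH; ring].
Qed.

Lemma lsum_app (A : Type) (f : A -> R) (l1 l2 : list A) :
  lsum f (l1 ++ l2) = lsum f l1 + lsum f l2.
Proof.
  induction l1 as [|a l IH]; unfold lsum in *; simpl; [ring|rewrite IH; ring].
Qed.

(** Each nonzero entry of [l] is struck once from [l']; [NoDup l] prevents striking the same one
    twice. Used in both directions, it shows that sums depend only on the support. *)
Lemma lsum_support_le (A : Type) (f : A -> R) (l l' : list A) :
  NoDup l -> (forall v, 0 <= f v) -> (forall v, In v l -> f v <> 0 -> In v l') ->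
  lsum f l <= lsum f l'.
Proof.
  intros Hl Hf. revert l'. induction Hl as [|a l Ha Hl IH]; intros l' H.
  - apply lsum_nonneg, Hf.
  - change (lsum f (a :: l)) with (f a + lsum f l).
    destruct (Req_dec (f a) 0) as [E|E].
    + rewrite E, Rplus_0_l. apply IH. intros v Hv. apply H; right; exact Hv.
    + assert (Hin : In a l') by (apply H; [left; reflexivity|exact E]).
      destruct (in_split _ _ Hin) as [l1 [l2 ->]].
      rewrite lsum_app. change (lsum f (a :: l2)) with (f a + lsum f l2).
      assert (lsum f l <= lsum f (l1 ++ l2)).
      { apply IH. intros v Hv Hv0.
        assert (Hv' : In v (l1 ++ a :: l2)) by (apply H; [right; exact Hv|exact Hv0]).
        apply in_app_or in Hv'. apply in_or_app.
        destruct Hv' as [|[->|]]; [left|contradiction|right]; assumption. }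
      rewrite lsum_app in H0. lra.
Qed.

Lemma lsum_In_le (A : Type) (f : A -> R) (l : list A) (v : A) :
  (forall v, 0 <= f v) -> In v l -> f v <= lsum f l.
Proof.
  intros Hf Hv.
  assert (H : lsum f (v :: nil) <= lsum f l).
  { apply lsum_support_le; [constructor; [intros []|constructor]|exact Hf|].
    intros w [<-|[]] _; exact Hv. }
  unfold lsum in H at 1; simpl in H; lra.
Qed.

Lemma lsum_cv (A : Type) (u : nat -> A -> R) (x : A -> R) (l : list A) :
  (forall v, In v l -> Un_cv (fun n => u n v) (x v)) ->
  Un_cv (fun n => lsum (u n) l) (lsum x l).
Proof.
  induction l as [|a l IH]; intro H.
  - intros e He. exists 0%nat. intros n _. unfold lsum; simpl.
    unfold Rdist. rewrite Rminus_diag, Rabs_R0. exact He.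
  - change (Un_cv (fun n => u n a + lsum (u n) l) (x a + lsum x l)).
    apply CV_plus; [apply H; left; reflexivity|].
    apply IH. intros; apply H; right; assumption.
Qed.

(** The factor 1/2 puts distinct vertices at distance 1, as in [simplex_dist]. A duplicate-free list
    that misses part of the supports gives a smaller value, still usable as a lower bound. *)
Definition edist (A : Type) (l : list A) (x y : A -> R) : R :=
  sqrt (lsum (fun v => (x v - y v) ^ 2) l / 2).

Lemma edist_sqr (A : Type) (l : list A) (x y : A -> R) :
  edist l x y ^ 2 = lsum (fun v => (x v - y v) ^ 2) l / 2.
Proof.
  unfold edist. rewrite <- Rsqr_pow2, Rsqr_sqrt; [reflexivity|].
  apply Rmult_le_pos; [|lra]. apply lsum_nonneg; intro; apply pow2_ge_0.
Qed.

Lemma edist_pos (A : Type) (l : list A) (x y : A -> R) : 0 <= edist l x y.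
Proof. apply sqrt_pos. Qed.

Lemma edist_sym (A : Type) (l : list A) (x y : A -> R) : edist l x y = edist l y x.
Proof.
  unfold edist. do 2 f_equal. unfold lsum. f_equal. apply map_ext; intro; ring.
Qed.

Lemma edist_refl (A : Type) (l : list A) (x : A -> R) : edist l x x = 0.
Proof.
  unfold edist.
  replace (lsum (fun v => (x v - x v) ^ 2) l) with 0; [rewrite Rdiv_0_l; apply sqrt_0|].
  rewrite <- (Rmult_0_r (INR (length l))), <- lsum_const.
  unfold lsum. f_equal. apply map_ext; intro; ring.
Qed.

Lemma edist_support_le (A : Type) (l l' : list A) (x y : A -> R) :
  NoDup l -> (forall v, x v <> 0 \/ y v <> 0 -> In v l') -> edist l x y <= edist l' x y.
Proof.
  intros Hl H. apply sqrt_le_1_alt, Rmult_le_compat_r; [lra|].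
  apply lsum_support_le; [exact Hl|intro; apply pow2_ge_0|].
  intros v _ Hv. apply H.
  destruct (Req_dec (x v) 0) as [E|E]; [|left; exact E].
  destruct (Req_dec (y v) 0) as [E'|E']; [|right; exact E'].
  exfalso; apply Hv. rewrite E, E'; ring.
Qed.

Lemma sqrt_sum_triangle (a b p q : R) :
  0 <= p -> 0 <= q ->
  sqrt ((a + b) ^ 2 + (p + q) ^ 2) <= sqrt (a ^ 2 + p ^ 2) + sqrt (b ^ 2 + q ^ 2).
Proof.
  intros Hp Hq.
  pose proof (triangle 0 0 (a + b) (p + q) a p) as H. unfold dist_euc, Rsqr in H.
  replace ((a + b) ^ 2 + (p + q) ^ 2) with
    ((0 - (a + b)) * (0 - (a + b)) + (0 - (p + q)) * (0 - (p + q))) by ring.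
  replace (a ^ 2 + p ^ 2) with ((0 - a) * (0 - a) + (0 - p) * (0 - p)) by ring.
  replace (b ^ 2 + q ^ 2) with
    ((a - (a + b)) * (a - (a + b)) + (p - (p + q)) * (p - (p + q))) by ring.
  exact H.
Qed.

Lemma edist_triangle (A : Type) (l : list A) (x y z : A -> R) :
  edist l x z <= edist l x y + edist l y z.
Proof.
  (* Splitting off one coordinate makes the distance a hypotenuse, so the induction step is the
     triangle inequality in the plane. *)
  assert (Hcons : forall (a : A) (l : list A) (x y : A -> R),
    edist (a :: l) x y = sqrt (((x a - y a) / sqrt 2) ^ 2 + edist l x y ^ 2)).
  { intros a l' x' y'. rewrite edist_sqr. unfold edist, lsum; simpl. f_equal.
    assert (Hs : sqrt 2 * sqrt 2 = 2) by (apply sqrt_sqrt; lra).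
    assert (sqrt 2 <> 0) by (intro E; rewrite E in Hs; lra).
    set (r := sqrt 2) in *. rewrite <- Hs. field. assumption. }
  induction l as [|a l IH].
  - unfold edist, lsum; simpl. rewrite Rdiv_0_l, sqrt_0. lra.
  - rewrite !Hcons. eapply Rle_trans; [|apply sqrt_sum_triangle; apply edist_pos].
    apply sqrt_le_1_alt.
    replace ((x a - y a) / sqrt 2 + (y a - z a) / sqrt 2) with ((x a - z a) / sqrt 2)
      by (unfold Rdiv; ring).
    apply Rplus_le_compat_l, pow_incr. split; [apply edist_pos|exact IH].
Qed.

Lemma edist_coord (A : Type) (l : list A) (x y : A -> R) (v : A) :
  In v l -> (x v - y v) ^ 2 <= 2 * edist l x y ^ 2.
Proof.
  intro Hv. rewrite edist_sqr.
  pose proof (lsum_In_le (fun v => (x v - y v) ^ 2) l v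
    (fun w => pow2_ge_0 (x w - y w)) Hv) as H.
  cbv beta in H. lra.
Qed.

Definition vertex (A : Type) (v : A) : A -> R := fun w => if eq_dec_cl w v then 1 else 0.

(** Only the coordinate [v] sees the vertex, where (1 - x v)^2 = 1 - 2 x v + (x v)^2. All
    comparisons with the squared radius 1/2 rest on this formula. *)
Lemma edist_vertex (A : Type) (l : list A) (v : A) (x : A -> R) :
  NoDup l -> In v l ->
  edist l (vertex v) x ^ 2 = (1 - 2 * x v + lsum (fun w => x w ^ 2) l) / 2.
Proof.
  intros Hl Hv. rewrite edist_sqr. f_equal.
  assert (Hout : forall l, ~ In v l ->
    lsum (fun w => (vertex v w - x w) ^ 2) l = lsum (fun w => x w ^ 2) l).
  { intros l' H. unfold lsum. f_equal. apply map_ext_in. intros w Hw.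
    unfold vertex. destruct (eq_dec_cl w v) as [->|]; [contradiction|ring]. }
  destruct (in_split _ _ Hv) as [l1 [l2 ->]].
  apply NoDup_remove_2 in Hl. rewrite in_app_iff in Hl.
  rewrite !lsum_app.
  change (lsum ?f (v :: l2)) with (f v + lsum f l2). cbv beta.
  rewrite !Hout by tauto. unfold vertex.
  destruct (eq_dec_cl v v) as [_|]; [ring|congruence].
Qed.

(** * The standard metric and the midpoint inequality *)

Lemma complex_face (V : Type) (K : complex V) (s t : vset V) (v : V) :
  is_complex K -> K s -> (forall w, t w -> s w) -> t v -> K t.
Proof.
  intros [_ [_ [H _]]] Hs Hts Hv. apply (H s t Hs Hts). exists v; exact Hv.
Qed.

Lemma complex_vertex (V : Type) (K : complex V) (s : vset V) (v : V) :
  is_complex K -> K s -> s v -> K (fun w => w = v).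
Proof.
  intros HK Hs Hv. apply (@complex_face V K s _ v HK Hs); [|reflexivity].
  intros w ->; exact Hv.
Qed.

Lemma is_point_intro (V : Type) (K : complex V) (x : V -> R) (l : list V) :
  (forall v, 0 <= x v) -> K (fun v => x v <> 0) -> NoDup l ->
  (forall v, x v <> 0 -> In v l) -> lsum x l = 1 -> is_point K x.
Proof.
  intros Hx HK Hl Hsub Hsum.
  (* [is_point] asks for a list that is exactly the support, so the zero coordinates are filtered
     out; the sum does not change. *)
  set (p := fun v => if Req_dec_T (x v) 0 then false else true).
  assert (Hp : forall v, In v (filter p l) <-> x v <> 0).
  { intro v. rewrite filter_In. unfold p. destruct (Req_dec_T (x v) 0) as [E|E].
    - split; [intros [_ H]; discriminate|intro H; contradiction].
    - split; [intros _; exact E|intros H; split; [apply Hsub, H|reflexivity]]. }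
  split; [exact Hx|split; [exact HK|]].
  exists (filter p l). split; [apply NoDup_filter, Hl|split].
  - intro v; symmetry; apply Hp.
  - change (lsum x (filter p l) = 1). rewrite <- Hsum. apply Rle_antisym.
    + apply lsum_support_le; [apply NoDup_filter, Hl|exact Hx|].
      intros v Hv _. apply filter_In in Hv. apply Hv.
    + apply lsum_support_le; [exact Hl|exact Hx|]. intros v _ Hv; apply Hp, Hv.
Qed.

Lemma point_sum (V : Type) (K : complex V) (x : V -> R) (l : list V) :
  is_point K x -> NoDup l -> (forall v, x v <> 0 -> In v l) -> lsum x l = 1.
Proof.
  intros [Hx [_ [l' [Hl' [Hs Hsum]]]]] Hl Hsub.
  change (lsum x l' = 1) in Hsum. rewrite <- Hsum. apply Rle_antisym.
  - apply lsum_support_le; [exact Hl|exact Hx|]. intros v _ Hv; apply Hs, Hv.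
  - apply lsum_support_le; [exact Hl'|exact Hx|]. intros v _ Hv; apply Hsub, Hv.
Qed.

Lemma point_support (V : Type) (K : complex V) (x : V -> R) :
  is_point K x -> exists l, NoDup l /\ (forall v, x v <> 0 <-> In v l).
Proof. intros [_ [_ [l [Hl [Hs _]]]]]. exists l; split; assumption. Qed.

Lemma point_supports (V : Type) (K : complex V) (x y : V -> R) :
  is_point K x -> is_point K y ->
  exists l, NoDup l /\ forall v, x v <> 0 \/ y v <> 0 -> In v l.
Proof.
  intros Hx Hy.
  destruct (point_support Hx) as [l1 [_ H1]], (point_support Hy) as [l2 [_ H2]].
  exists (nodup (@eq_dec_cl V) (l1 ++ l2)). split; [apply NoDup_nodup|].
  intros v Hv. rewrite nodup_In, in_app_iff, <- H1, <- H2. exact Hv.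
Qed.

Lemma point_sqr_sum (V : Type) (K : complex V) (x : V -> R) (l : list V) :
  is_point K x -> NoDup l -> (forall v, x v <> 0 -> In v l) ->
  0 < lsum (fun v => x v ^ 2) l.
Proof.
  intros Hx Hl Hs.
  destruct (Rle_lt_or_eq_dec 0 (lsum (fun v => x v ^ 2) l)) as [H|H];
    [apply lsum_nonneg; intro; apply pow2_ge_0|exact H|exfalso].
  assert (H0 : lsum x l <= lsum (fun _ => 0) l).
  { apply lsum_le. intros v Hv.
    pose proof (lsum_In_le (fun v => x v ^ 2) l v (fun w => pow2_ge_0 (x w)) Hv) as E.
    cbv beta in E. nra. }
  rewrite (point_sum Hx Hl Hs), lsum_const, Rmult_0_r in H0. lra.
Qed.

Lemma vertex_neq0 (V : Type) (v w : V) : vertex v w <> 0 <-> w = v.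
Proof. unfold vertex. destruct (eq_dec_cl w v); split; intros; [assumption|lra|lra|contradiction]. Qed.

Lemma vertex_point (V : Type) (K : complex V) (v : V) :
  is_complex K -> K (fun w => w = v) -> is_point K (vertex v).
Proof.
  intros HK Hv. apply is_point_intro with (l := v :: nil).
  - intro w. unfold vertex. destruct (eq_dec_cl w v); lra.
  - destruct HK as [_ [H _]]. apply (H _ _ Hv). intro w. symmetry; apply vertex_neq0.
  - constructor; [intros []|constructor].
  - intros w Hw. left. symmetry. apply vertex_neq0, Hw.
  - unfold lsum, vertex; simpl. destruct (eq_dec_cl v v); [ring|congruence].
Qed.

(** Barycentric coordinates map |K| into a Euclidean space, where a chain becomes a broken line, at
    least as long as the straight segment between its ends. *)
Lemma chain_edist (V : Type) (K : complex V) (x y : V -> R) (r : R) (l : list V) :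
  chain K x y r -> NoDup l -> edist l x y <= r.
Proof.
  intros H Hl. induction H as [x Hx|x y z r s Hx Hxy Hr H IH].
  - rewrite edist_refl; lra.
  - destruct Hr as [l' [Hl' [Hs ->]]].
    change (edist l x z <= edist l' x y + s).
    pose proof (edist_triangle l x y z). pose proof (@edist_support_le V l l' x y Hl Hs). lra.
Qed.

Lemma chain_points (V : Type) (K : complex V) (x y : V -> R) (r : R) :
  chain K x y r -> is_point K x /\ is_point K y.
Proof. intro H; induction H; tauto. Qed.

Lemma chain_app (V : Type) (K : complex V) (x y z : V -> R) (r s : R) :
  chain K x y r -> chain K y z s -> chain K x z (r + s).
Proof.
  intros H H'. induction H as [x Hx|x y' y r r' Hx Hc Hr H IH].
  - rewrite Rplus_0_l; exact H'.
  - rewrite Rplus_assoc. apply chain_cons with y'; auto.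
Qed.

Lemma chain_edge (V : Type) (K : complex V) (x y : V -> R) (l : list V) :
  is_point K x -> is_point K y -> in_common_simplex K x y -> NoDup l ->
  (forall v, x v <> 0 \/ y v <> 0 -> In v l) -> chain K x y (edist l x y).
Proof.
  intros Hx Hy Hc Hl Hs. rewrite <- (Rplus_0_r (edist l x y)).
  apply chain_cons with y; auto; [|constructor; exact Hy].
  exists l; auto.
Qed.

Lemma chain_sym (V : Type) (K : complex V) (x y : V -> R) (r : R) :
  chain K x y r -> chain K y x r.
Proof.
  intro H. induction H as [x Hx|x y z r s Hx Hc Hr H IH]; [constructor; exact Hx|].
  rewrite Rplus_comm. apply chain_app with y; [exact IH|].
  destruct Hr as [l [Hl [Hs ->]]]. change (chain K y x (edist l x y)).
  rewrite edist_sym. apply chain_edge.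
  - apply (chain_points H).
  - exact Hx.
  - destruct Hc as [s' [Hs' Hc]]. exists s'; split; [exact Hs'|].
    intros v Hv; apply Hc; tauto.
  - exact Hl.
  - intros v Hv; apply Hs; tauto.
Qed.

Section Metric.
Variables (V : Type) (K : complex V) (d : (V -> R) -> (V -> R) -> R).
Hypothesis Hd : std_metric K d.

Lemma edist_le_d x y l : is_point K x -> is_point K y -> NoDup l -> edist l x y <= d x y.
Proof.
  intros Hx Hy Hl. apply (Hd Hx Hy). intros r Hr. exact (chain_edist Hr Hl).
Qed.

Lemma d_le_edist x y l :
  is_point K x -> is_point K y -> in_common_simplex K x y -> NoDup l ->
  (forall v, x v <> 0 \/ y v <> 0 -> In v l) -> d x y <= edist l x y.
Proof.
  intros Hx Hy Hc Hl Hs. apply (Hd Hx Hy). apply chain_edge; assumption.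
Qed.

Lemma d_nonneg x y : is_point K x -> is_point K y -> 0 <= d x y.
Proof.
  intros Hx Hy. eapply Rle_trans; [|apply (edist_le_d Hx Hy (NoDup_nil V))].
  apply edist_pos.
Qed.

Lemma d_refl x : is_point K x -> d x x = 0.
Proof.
  intro Hx. apply Rle_antisym; [|apply d_nonneg; assumption].
  apply (Hd Hx Hx). constructor; exact Hx.
Qed.

Lemma d_sym x y : is_point K x -> is_point K y -> d x y = d y x.
Proof.
  intros Hx Hy. apply Rle_antisym.
  - apply (Hd Hy Hx). intros r Hr. apply (Hd Hx Hy), chain_sym, Hr.
  - apply (Hd Hx Hy). intros r Hr. apply (Hd Hy Hx), chain_sym, Hr.
Qed.

Lemma d_triangle x y z :
  is_point K x -> is_point K y -> is_point K z -> d x z <= d x y + d y z.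
Proof.
  intros Hx Hy Hz.
  (* Each [cut] isolates one distance on the right, so that its greatest-lower-bound property
     applies. *)
  cut (d x z - d y z <= d x y); [lra|].
  apply (Hd Hx Hy). intros r Hr.
  cut (d x z - r <= d y z); [lra|].
  apply (Hd Hy Hz). intros s Hs.
  cut (d x z <= r + s); [lra|].
  apply (Hd Hx Hz). exact (chain_app Hr Hs).
Qed.

(** Coordinates are Lipschitz for [d]. This separates points, gives coordinatewise limits of Cauchy
    sequences, and keeps a large coordinate nonzero under a short move. *)
Lemma d_coord x y v :
  is_point K x -> is_point K y -> (x v - y v) ^ 2 <= 2 * d x y ^ 2.
Proof.
  intros Hx Hy.
  assert (Hl : NoDup (v :: nil)) by (constructor; [intros []|constructor]).
  pose proof (edist_coord (v :: nil) x y v (or_introl eq_refl)) as H.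
  pose proof (edist_le_d Hx Hy Hl). pose proof (edist_pos (v :: nil) x y). nra.
Qed.

Lemma d_eq0 x y : is_point K x -> is_point K y -> d x y = 0 -> x = y.
Proof.
  intros Hx Hy H. apply functional_extensionality; intro v.
  pose proof (d_coord v Hx Hy) as E. rewrite H in E.
  assert (E' : (x v - y v) ^ 2 = 0) by (pose proof (pow2_ge_0 (x v - y v)); lra).
  destruct (Req_dec (x v - y v) 0) as [F|F]; [lra|].
  exfalso. apply (pow_nonzero _ 2 F E').
Qed.

(* The Bruhat-Tits inequality: the CAT(0) condition for a vertex of a triangle
   and the midpoint of the opposite side. *)
Definition midpoint_ineq : Prop :=
  forall p q, is_point K p -> is_point K q ->
  exists m, is_point K m /\ forall r, is_point K r ->
    d r m ^ 2 <= (d r p ^ 2 + d r q ^ 2) / 2 - d p q ^ 2 / 4.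

(** With the side [a] laid from (0,0) to (a,0), the law of cosines gives the abscissa [u] of the
    third vertex. The triangle inequalities give |u| <= b, so the height is real. *)
Lemma comparison_triangle a b c :
  0 < a -> 0 <= b -> 0 <= c -> a <= b + c -> b <= a + c -> c <= a + b ->
  exists u h, u ^ 2 + h ^ 2 = b ^ 2 /\ (a - u) ^ 2 + h ^ 2 = c ^ 2.
Proof.
  intros Ha Hb Hc H1 H2 H3.
  set (u := (a ^ 2 + b ^ 2 - c ^ 2) / (2 * a)).
  assert (Hu : 2 * a * u = a ^ 2 + b ^ 2 - c ^ 2) by (unfold u; field; lra).
  exists u, (sqrt (b ^ 2 - u ^ 2)).
  assert (Hub : 0 <= b ^ 2 - u ^ 2).
  { assert (u <= b) by (apply Rmult_le_reg_l with (2 * a); nra).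
    assert (- b <= u) by (apply Rmult_le_reg_l with (2 * a); nra).
    nra. }
  assert (Hh : sqrt (b ^ 2 - u ^ 2) ^ 2 = b ^ 2 - u ^ 2).
  { rewrite <- Rsqr_pow2. apply Rsqr_sqrt, Hub. }
  rewrite Hh. split; [ring|]. nra.
Qed.

Lemma CAT0_midpoint_ineq : geodesic_space K d -> CAT0 K d -> midpoint_ineq.
Proof.
  intros Hg HC p q Hp Hq.
  (* If [p] and [q] coincide there is no side to bisect, and [p] itself is the midpoint. *)
  destruct (Rle_lt_or_eq_dec 0 (d p q) (d_nonneg Hp Hq)) as [Ha|Ha].
  2:{ exists p; split; [exact Hp|]. intros r Hr.
      rewrite (d_eq0 Hp Hq (eq_sym Ha)), d_refl by exact Hq. lra. }
  destruct (Hg p q Hp Hq) as [c1 Hc1].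
  exists (c1 (d p q / 2)).
  assert (Hm : is_point K (c1 (d p q / 2))) by (apply (proj2 (proj2 Hc1) _ 0); lra).
  split; [exact Hm|]. intros r Hr.
  destruct (Hg q r Hq Hr) as [c2 Hc2], (Hg r p Hr Hp) as [c3 Hc3].
  pose proof (d_nonneg Hr Hp) as Hb. pose proof (d_nonneg Hq Hr) as Hc.
  assert (Htri : exists u h, u ^ 2 + h ^ 2 = d r p ^ 2 /\ (d p q - u) ^ 2 + h ^ 2 = d q r ^ 2).
  { apply comparison_triangle; auto.
    - rewrite (d_sym Hr Hp), (d_sym Hq Hr). apply d_triangle; assumption.
    - rewrite (d_sym Hr Hp), Rplus_comm, (d_sym Hq Hr).
      rewrite (d_sym Hr Hq), Rplus_comm. apply d_triangle; assumption.
    - rewrite Rplus_comm, (d_sym Hq Hr), (d_sym Hr Hq), (d_sym Hq Hr).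
      apply d_triangle; assumption. }
  destruct Htri as [u [h [E1 E2]]].
  assert (Hx : d (c1 (d p q / 2)) r <= dist2 (d p q / 2, 0) (u, h)).
  { apply (HC p q r c1 c2 c3 (0, 0) (d p q, 0) (u, h)); auto.
    - unfold dist2; simpl fst; simpl snd.
      replace ((0 - d p q) ^ 2 + (0 - 0) ^ 2) with (d p q ^ 2) by ring.
      apply sqrt_pow2; lra.
    - unfold dist2; simpl fst; simpl snd.
      replace ((d p q - u) ^ 2 + (0 - h) ^ 2) with (d q r ^ 2) by (rewrite <- E2; ring).
      apply sqrt_pow2; lra.
    - unfold dist2; simpl fst; simpl snd.
      replace ((u - 0) ^ 2 + (h - 0) ^ 2) with (d r p ^ 2) by (rewrite <- E1; ring).
      apply sqrt_pow2; lra.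
    - left. exists (d p q / 2). split; [lra|split; [reflexivity|]].
      simpl. f_equal; field; lra.
    (* [r] is the start of [c3]. At parameter 0 the quotient by [d r p] is 0 even when that distance
       vanishes. *)
    - right; right. exists 0. split; [lra|split; [symmetry; apply Hc3|]].
      simpl. unfold Rdiv. f_equal; ring. }
  rewrite (d_sym Hm Hr) in Hx.
  apply (fun H => pow_incr _ _ 2 (conj (d_nonneg Hr Hm) H)) in Hx.
  unfold dist2 in Hx; simpl fst in Hx; simpl snd in Hx.
  rewrite <- (Rsqr_pow2 (sqrt _)), Rsqr_sqrt in Hx.
  2:{ pose proof (pow2_ge_0 (d p q / 2 - u)); pose proof (pow2_ge_0 (0 - h)); lra. }
  (* The squared distance from (u,h) to (a/2,0) is the right-hand side, by the median formula in the
     plane. *)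
  rewrite (d_sym Hr Hq). nra.
Qed.
End Metric.

(** * Balls around vertices and nearest points *)

Lemma list_argmax (A : Type) (f : A -> R) (l : list A) :
  l <> nil -> exists a, In a l /\ forall b, In b l -> f b <= f a.
Proof.
  induction l as [|a l IH]; intro H; [congruence|].
  destruct l as [|a' l'].
  - exists a. split; [left; reflexivity|]. intros b [->|[]]; lra.
  - destruct IH as [m [Hm Hmax]]; [discriminate|].
    destruct (Rle_dec (f m) (f a)) as [Hle|Hgt].
    + exists a. split; [left; reflexivity|]. intros b [->|Hb]; [lra|].
      specialize (Hmax b Hb); lra.
    + exists m. split; [right; exact Hm|]. intros b [->|Hb]; [lra|]. apply Hmax, Hb.
Qed.

Lemma eventually_list (A : Type) (P : A -> nat -> Prop) (l : list A) :
  (forall a, In a l -> exists N, forall n, (N <= n)%nat -> P a n) ->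
  exists N, forall n, (N <= n)%nat -> forall a, In a l -> P a n.
Proof.
  induction l as [|a l IH]; intro H.
  - exists 0%nat. intros n _ a [].
  - destruct (H a (or_introl eq_refl)) as [N1 H1].
    destruct IH as [N2 H2]; [intros b Hb; apply H; right; exact Hb|].
    exists (Nat.max N1 N2). intros n Hn b [<-|Hb]; [apply H1; lia|apply H2; [lia|exact Hb]].
Qed.

Lemma inf_exists (E : R -> Prop) :
  (exists t, E t) -> (forall t, E t -> 0 <= t) ->
  exists m, (forall t, E t -> m <= t) /\ forall e, 0 < e -> exists t, E t /\ t < m + e.
Proof.
  intros [t0 Ht0] Hpos.
  destruct (completeness (fun t => E (- t))) as [m [Hub Hlub]].
  - exists 0. intros t Ht. specialize (Hpos _ Ht); lra.
  - exists (- t0). rewrite Ropp_involutive; exact Ht0.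
  - exists (- m). split.
    + intros t Ht. assert (- t <= m) by (apply Hub; rewrite Ropp_involutive; exact Ht). lra.
    + intros e He. apply NNPP; intro Hno.
      assert (m <= m - e); [|lra].
      apply Hlub. intros t Ht. destruct (Rle_dec t (m - e)) as [h|h]; [exact h|].
      exfalso; apply Hno. exists (- t). split; [exact Ht|lra].
Qed.

Lemma point_max_coord (V : Type) (K : complex V) (x : V -> R) (l : list V) :
  is_point K x -> NoDup l -> (forall v, x v <> 0 -> In v l) ->
  exists v, In v l /\ forall w, x w <= x v.
Proof.
  intros Hx Hl Hs.
  destruct (list_argmax x (l := l)) as [v [Hv Hmax]].
  - intros ->. pose proof (point_sum Hx Hl Hs) as E. unfold lsum in E; simpl in E; lra.
  - exists v; split; [exact Hv|]. intro w.
    destruct (Req_dec (x w) 0) as [->|Hw]; [apply Hx|apply Hmax, Hs, Hw].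
Qed.

Definition add (V : Type) (s : vset V) (v : V) : vset V := fun w => s w \/ w = v.
Definition del (V : Type) (s : vset V) (v : V) : vset V := fun w => s w /\ w <> v.

Section Balls.
Variables (V : Type) (K : complex V) (d : (V -> R) -> (V -> R) -> R).
Hypothesis HK : is_complex K.
Hypothesis Hd : std_metric K d.

(** The coordinates converge, and since all supports lie in one finite list, the support of the
    limit is eventually contained in that of [u n]. The limit then shares a simplex with [u n],
    where [d] is bounded by [edist], so coordinatewise convergence suffices. *)
Lemma cauchy_limit (W : list V) (u : nat -> V -> R) :
  (forall n, is_point K (u n)) -> (forall n v, u n v <> 0 -> In v W) ->
  (forall e, 0 < e -> exists N, forall n m, (N <= n)%nat -> (N <= m)%nat -> d (u n) (u m) < e) ->
  exists x, is_point K x /\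
    forall e, 0 < e -> exists N, forall n, (N <= n)%nat -> d x (u n) < e.
Proof.
  intros Hu HW0 Hc.
  assert (exists W', NoDup W' /\ forall n v, u n v <> 0 -> In v W') as [W' [HND HW]].
  { exists (nodup (@eq_dec_cl V) W). split; [apply NoDup_nodup|].
    intros n v Hv. apply nodup_In. exact (HW0 n v Hv). }
  clear W HW0.
  assert (Hcc : forall v, Cauchy_crit (fun n => u n v)).
  { intros v e He. destruct (Hc (e / 2)) as [N HN]; [lra|].
    exists N. intros n m Hn Hm. specialize (HN n m Hn Hm).
    pose proof (d_coord Hd v (Hu n) (Hu m)) as E.
    pose proof (d_nonneg Hd (Hu n) (Hu m)).
    unfold Rdist.
    apply Rabs_def1; nra. }
  set (x := fun v => proj1_sig (R_complete _ (Hcc v))).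
  assert (Hx : forall v, Un_cv (fun n => u n v) (x v)).
  { intro v. unfold x. destruct (R_complete _ (Hcc v)) as [l Hl]; exact Hl. }
  assert (Hx0 : forall v, 0 <= x v).
  { intro v. destruct (Rle_dec 0 (x v)) as [h|h]; [exact h|exfalso].
    destruct (Hx v (- x v)) as [N HN]; [lra|].
    specialize (HN N (le_n N)). unfold Rdist in HN. apply Rabs_def2 in HN.
    destruct (Hu N) as [H0 _]. specialize (H0 v). lra. }
  assert (Hev : forall v, x v <> 0 -> exists N, forall n, (N <= n)%nat -> u n v <> 0).
  { intros v Hv. destruct (Hx v (x v)) as [N HN]; [specialize (Hx0 v); lra|].
    exists N. intros n Hn E. specialize (HN n Hn). rewrite E in HN.
    unfold Rdist in HN. apply Rabs_def2 in HN. lra. }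
  assert (HxW : forall v, x v <> 0 -> In v W').
  { intros v Hv. destruct (Hev v Hv) as [N HN]. apply (HW N), HN, le_n. }
  assert (Hsum : lsum x W' = 1).
  { apply UL_sequence with (fun n => lsum (u n) W').
    - apply lsum_cv. intros; apply Hx.
    - intros e He. exists 0%nat. intros n _.
      rewrite (point_sum (Hu n) HND (HW n)). unfold Rdist.
      rewrite Rminus_diag, Rabs_R0; exact He. }
  destruct (eventually_list (fun v n => x v <> 0 -> u n v <> 0) W') as [N HN].
  { intros v _. destruct (Req_dec (x v) 0) as [E|E].
    - exists 0%nat. intros; contradiction.
    - destruct (Hev v E) as [N HN]. exists N. intros; apply HN; assumption. }
  assert (Hsub : forall n, (N <= n)%nat -> forall v, x v <> 0 -> u n v <> 0).
  { intros n Hn v Hv. apply (HN n Hn v (HxW v Hv) Hv). }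
  assert (Hpt : is_point K x).
  { apply is_point_intro with W'; auto.
    assert (exists v, x v <> 0) as [v Hv].
    { apply NNPP; intro Hno.
      assert (H : lsum x W' <= lsum (fun _ => 0) W').
      { apply lsum_le. intros v _. destruct (Req_dec (x v) 0) as [->|E]; [lra|].
        exfalso; apply Hno; exists v; exact E. }
      rewrite lsum_const in H; lra. }
    apply (@complex_face V K (fun v => u N v <> 0) _ v HK); [apply (Hu N)| |exact Hv].
    apply Hsub, le_n. }
  exists x; split; [exact Hpt|]. intros e He.
  assert (Hcv : Un_cv (fun n => lsum (fun v => (x v - u n v) ^ 2) W') (lsum (fun _ => 0) W')).
  { apply (lsum_cv (fun n v => (x v - u n v) ^ 2)). intros v _ e' He'.
    (* A difference below both 1 and e' has its square below e'. *)
    destruct (Hx v (Rmin 1 e')) as [N' HN']; [apply Rmin_glb_lt; lra|].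
    exists N'. intros n Hn. specialize (HN' n Hn).
    pose proof (Rmin_l 1 e'). pose proof (Rmin_r 1 e').
    unfold Rdist in *. apply Rabs_def2 in HN'. apply Rabs_def1; nra. }
  destruct (Hcv (e ^ 2)) as [N' HN']; [nra|].
  exists (Nat.max N N'). intros n Hn.
  assert (HN'n := HN' n ltac:(lia)). unfold Rdist in HN'n. apply Rabs_def2 in HN'n.
  rewrite lsum_const, Rmult_0_r in HN'n.
  assert (Hle : d x (u n) <= edist W' x (u n)).
  { apply (d_le_edist Hd); auto.
    - exists (fun v => u n v <> 0). split; [apply (Hu n)|].
      intros v [Hv|Hv]; [apply (Hsub n); [lia|exact Hv]|exact Hv].
    - intros v [Hv|Hv]; [apply HxW, Hv|exact (HW n v Hv)]. }
  pose proof (edist_sqr W' x (u n)) as E. pose proof (edist_pos W' x (u n)).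
  nra.
Qed.

(** If x v = 0, the Euclidean lower bound is (1 + sum of squares)/2, which exceeds 1/2. So the ball
    of [v] lies in the open star of [v]. *)
Lemma d_vertex_lower v x : K (fun w => w = v) -> is_point K x ->
  d (vertex v) x ^ 2 <= 1 / 2 -> x v <> 0.
Proof.
  intros Hv Hx H E.
  pose proof (vertex_point _ HK Hv) as Hvp.
  destruct (point_supports Hvp Hx) as [l [Hl Hs]].
  pose proof (edist_le_d Hd Hvp Hx Hl). pose proof (edist_pos l (vertex v) x).
  assert (Hvl : In v l) by (apply Hs; left; apply vertex_neq0; reflexivity).
  pose proof (@edist_vertex V l v x Hl Hvl) as Eq.
  pose proof (point_sqr_sum Hx Hl (fun w Hw => Hs w (or_intror Hw))).
  rewrite E in Eq. nra.
Qed.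

Lemma d_vertex_upper v x l : is_point K x -> x v <> 0 ->
  NoDup l -> (forall w, x w <> 0 -> In w l) ->
  d (vertex v) x ^ 2 <= (1 - 2 * x v + lsum (fun w => x w ^ 2) l) / 2.
Proof.
  intros Hx Hxv Hl Hs.
  assert (HxK : K (fun w => x w <> 0)) by apply Hx.
  assert (Hvp : is_point K (vertex v)).
  { apply (vertex_point _ HK). exact (complex_vertex _ v HK HxK Hxv). }
  rewrite <- edist_vertex; [|exact Hl|apply Hs, Hxv].
  apply pow_incr. split; [apply (d_nonneg Hd); assumption|].
  apply (d_le_edist Hd); auto.
  - exists (fun w => x w <> 0). split; [exact HxK|].
    intros w [Hw|Hw]; [apply vertex_neq0 in Hw; subst; exact Hxv|exact Hw].
  - intros w [Hw|Hw]; [apply vertex_neq0 in Hw; subst; apply Hs, Hxv|apply Hs, Hw].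
Qed.

(** For the vertex with the largest coordinate, the sum of the squares is at most x v times the sum
    of the coordinates, which is x v. The squared distance is then at most (1 - x v)/2. *)
Lemma near_vertex x : is_point K x -> exists v, x v <> 0 /\ d (vertex v) x ^ 2 < 1 / 2.
Proof.
  intro Hx. destruct (point_support Hx) as [l [Hl Hs]].
  pose proof (fun v => proj1 (Hs v)) as Hs'.
  destruct (point_max_coord Hx Hl Hs') as [v [Hv Hmax]].
  exists v. apply Hs in Hv. split; [exact Hv|].
  pose proof (d_vertex_upper v Hx Hv Hl Hs') as H.
  assert (Hle : lsum (fun w => x w ^ 2) l <= lsum (fun w => x v * x w) l).
  { apply lsum_le. intros w _. specialize (Hmax w).
    destruct Hx as [H0 _]. specialize (H0 w). nra. }
  rewrite lsum_scal, (point_sum Hx Hl Hs') in Hle.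
  assert (0 < x v) by (destruct Hx as [H0 _]; specialize (H0 v); lra).
  lra.
Qed.

Definition in_balls (s : vset V) (x : V -> R) : Prop :=
  forall v, s v -> d (vertex v) x ^ 2 <= 1 / 2.

(** The barycenter of a simplex with k vertices has squared distance at most (1 - 1/k)/2 from each
    of them. *)
Lemma barycenter_in_balls s : K s -> exists x, is_point K x /\ in_balls s x.
Proof.
  intro Hs. destruct (proj1 HK s Hs) as [[l0 Hl0] [v0 Hv0]].
  assert (exists l, NoDup l /\ forall v, s v <-> In v l) as [l [Hl Hsl]].
  { exists (nodup (@eq_dec_cl V) l0). split; [apply NoDup_nodup|].
    intro v. rewrite nodup_In. apply Hl0. }
  set (k := INR (length l)).
  assert (Hk : 0 < k).
  { apply lt_0_INR. apply Hsl in Hv0. destruct l; [destruct Hv0|simpl; lia]. }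
  pose proof (Rinv_0_lt_compat k Hk) as Hk'.
  set (x := fun v => if excluded_middle_informative (s v) then / k else 0).
  assert (Hx1 : forall v, s v -> x v = / k).
  { intros v Hv. unfold x. destruct (excluded_middle_informative (s v)); [reflexivity|contradiction]. }
  assert (Hx2 : forall v, x v <> 0 <-> s v).
  { intro v. split; [|intro Hv; rewrite (Hx1 v Hv); lra].
    unfold x. destruct (excluded_middle_informative (s v)); [auto|lra]. }
  assert (Hsq : forall c, lsum (fun v => c * x v) l = c).
  { intro c. transitivity (lsum (fun _ => c * / k) l).
    - unfold lsum. f_equal. apply map_ext_in. intros v Hv. rewrite Hx1; [reflexivity|apply Hsl, Hv].
    - rewrite lsum_const. fold k. field. lra. }
  assert (Hpt : is_point K x).
  { apply is_point_intro with l; auto.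
    - intro v. destruct (classic (s v)) as [Hv|Hv]; [rewrite Hx1 by exact Hv; lra|].
      unfold x. destruct (excluded_middle_informative (s v)); [contradiction|lra].
    - destruct HK as [_ [H _]]. apply (H s _ Hs). intro v; symmetry; apply Hx2.
    - intros v Hv; apply Hsl, Hx2, Hv.
    - rewrite <- (Hsq 1). unfold lsum. f_equal. apply map_ext; intro; ring. }
  exists x. split; [exact Hpt|]. intros v Hv.
  eapply Rle_trans.
  - apply (@d_vertex_upper v x l); auto; [apply Hx2, Hv|]. intros w Hw; apply Hsl, Hx2, Hw.
  - replace (lsum (fun w => x w ^ 2) l) with (/ k); [rewrite (Hx1 v Hv); lra|].
    rewrite <- (Hsq (/ k)). unfold lsum. f_equal. apply map_ext_in. intros w Hw.
    rewrite Hx1; [ring|apply Hsl, Hw].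
Qed.

Lemma locally_finite_star : locally_finite K ->
  forall v, exists W, forall s, K s -> s v -> forall w, s w -> In w W.
Proof.
  intros HL v. destruct (classic (K (fun w => w = v))) as [Hv|Hv].
  - destruct (HL v Hv) as [ls Hls]. exists (concat ls). intros s Hs Hsv w Hw.
    destruct (Hls s Hs Hsv) as [l [Hl Hsame]].
    apply in_concat. exists l. split; [exact Hl|apply Hsame, Hw].
  - exists nil. intros s Hs Hsv. exfalso; apply Hv. exact (complex_vertex _ v HK Hs Hsv).
Qed.

(** * Nearest points in intersections of balls *)

Definition nearest (p : V -> R) (s : vset V) (y : V -> R) : Prop :=
  is_point K y /\ in_balls s y /\
  forall z, is_point K z -> in_balls s z -> d p y <= d p z.

Hypothesis Hmid : midpoint_ineq K d.
Variable p : V -> R.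
Hypothesis Hp : is_point K p.

(** Convexity of the balls in midpoint form: the midpoint inequality is applied once with each
    vertex of [s] and once with [p]. *)
Lemma in_balls_midpoint s x y : (forall v, s v -> K (fun w => w = v)) ->
  is_point K x -> is_point K y -> in_balls s x -> in_balls s y ->
  exists m, is_point K m /\ in_balls s m /\
    d p m ^ 2 <= (d p x ^ 2 + d p y ^ 2) / 2 - d x y ^ 2 / 4.
Proof.
  intros Hs Hx Hy Bx By. destruct (Hmid Hx Hy) as [m [Hm Hle]].
  exists m. split; [exact Hm|split; [|apply Hle, Hp]].
  intros v Hv. specialize (Hle (vertex v) (vertex_point _ HK (Hs v Hv))).
  specialize (Bx v Hv). specialize (By v Hv). pose proof (pow2_ge_0 (d x y)). lra.
Qed.

(** Two distinct nearest points would have a midpoint that is still in the balls and strictly closer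
    to [p]. *)
Lemma nearest_unique s y z : (forall v, s v -> K (fun w => w = v)) ->
  nearest p s y -> nearest p s z -> y = z.
Proof.
  intros Hs [Hy [By Hymin]] [Hz [Bz Hzmin]].
  destruct (in_balls_midpoint Hs Hy Hz By Bz) as [m [Hm [Bm Hle]]].
  apply (d_eq0 Hd Hy Hz).
  pose proof (Hymin z Hz Bz). pose proof (Hzmin y Hy By). pose proof (Hymin m Hm Bm).
  pose proof (d_nonneg Hd Hp Hy). pose proof (d_nonneg Hd Hy Hz).
  assert (E : d p z = d p y) by lra. rewrite E in Hle.
  assert (d p y ^ 2 <= d p m ^ 2) by (apply pow_incr; lra).
  nra.
Qed.

(** The midpoint inequality makes a minimizing sequence Cauchy. Its points lie in the ball, hence in
    the star, of one vertex of [s]; local finiteness bounds their supports, and [cauchy_limit]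
    applies. *)
Lemma nearest_exists s : locally_finite K -> K s -> exists y, nearest p s y.
Proof.
  intros HL Hs.
  assert (Hsv : forall v, s v -> K (fun w => w = v)).
  { intros v Hv. exact (complex_vertex _ v HK Hs Hv). }
  destruct (inf_exists (fun t => exists z, is_point K z /\ in_balls s z /\ t = d p z ^ 2))
    as [I [HI1 HI2]].
  { destruct (barycenter_in_balls Hs) as [x [Hx Bx]]. exists (d p x ^ 2), x; auto. }
  { intros t [z [_ [_ ->]]]. apply pow2_ge_0. }
  assert (Hex : forall n, exists z, is_point K z /\ in_balls s z /\ d p z ^ 2 < I + / INR (S n)).
  { intro n. destruct (HI2 (/ INR (S n))) as [t [[z [Hz [Bz ->]]] Ht]].
    - apply Rinv_0_lt_compat, lt_0_INR; lia.
    - exists z; auto. }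
  set (u := fun n => proj1_sig (constructive_indefinite_description _ (Hex n))).
  assert (Hu : forall n, is_point K (u n) /\ in_balls s (u n) /\ d p (u n) ^ 2 < I + / INR (S n)).
  { intro n. unfold u. destruct (constructive_indefinite_description _ (Hex n)); assumption. }
  assert (Hsmall : forall e, 0 < e -> exists N, forall n, (N <= n)%nat -> / INR (S n) < e).
  { intros e He. destruct (archimed_cor1 e He) as [N [HN HN0]]. exists N. intros n Hn.
    apply Rle_lt_trans with (/ INR N); [|exact HN].
    apply Rinv_le_contravar; [apply lt_0_INR; lia|apply le_INR; lia]. }
  destruct (proj1 HK s Hs) as [_ [v0 Hv0]].
  destruct (locally_finite_star HL v0) as [W HW].
  destruct (@cauchy_limit W u) as [x [Hx Hlim]].
  - intro n; apply Hu.
  - intros n v Hv. destruct (Hu n) as [Hpt [HB _]].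
    apply (HW _ (proj1 (proj2 Hpt))); [|exact Hv].
    apply d_vertex_lower; [apply Hsv, Hv0|exact Hpt|apply HB, Hv0].
  (* The midpoint [q] has squared distance at least [I], so d(u n, u m)^2 / 4 is at most the mean
     excess over [I], which is below e^2 / 4. *)
  - intros e He. destruct (Hsmall (e ^ 2 / 4)) as [N HN]; [nra|].
    exists N. intros n m Hn Hm. specialize (HN n Hn) as HNn. specialize (HN m Hm).
    destruct (Hu n) as [Hn1 [Hn2 Hn3]], (Hu m) as [Hm1 [Hm2 Hm3]].
    destruct (in_balls_midpoint Hsv Hn1 Hm1 Hn2 Hm2) as [q [Hq [Bq Hle]]].
    assert (I <= d p q ^ 2) by (apply HI1; exists q; auto).
    pose proof (d_nonneg Hd Hn1 Hm1). nra.
  - assert (Bx : in_balls s x).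
    { intros v Hv. pose proof (vertex_point _ HK (Hsv v Hv)) as Hvp.
      pose proof (d_nonneg Hd Hvp Hx) as Hpos.
      assert (Hr : sqrt (1 / 2) ^ 2 = 1 / 2) by (rewrite <- Rsqr_pow2; apply Rsqr_sqrt; lra).
      pose proof (sqrt_pos (1 / 2)) as Hr0.
      destruct (Rle_dec (d (vertex v) x) (sqrt (1 / 2))) as [h|h]; [nra|exfalso].
      destruct (Hlim (d (vertex v) x - sqrt (1 / 2))) as [N HN]; [lra|].
      specialize (HN N (le_n N)). destruct (Hu N) as [H1 [H2 _]].
      pose proof (d_triangle Hd Hvp H1 Hx) as Ht. rewrite (d_sym Hd H1 Hx) in Ht.
      specialize (H2 v Hv). pose proof (d_nonneg Hd Hvp H1). nra. }
    exists x. split; [exact Hx|split; [exact Bx|]]. intros z Hz Bz.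
    destruct (Rle_dec (d p x) (d p z)) as [h|h]; [exact h|exfalso].
    (* Half the gap: for large n, [u n] is at distance at least d p z + e from [p], while its
       squared distance is below (d p z)^2 + e^2. *)
    set (e := (d p x - d p z) / 2). assert (He : 0 < e) by (unfold e; lra).
    destruct (Hlim e He) as [N1 HN1]. destruct (Hsmall (e ^ 2)) as [N2 HN2]; [nra|].
    set (n := Nat.max N1 N2).
    specialize (HN1 n ltac:(lia)). specialize (HN2 n ltac:(lia)).
    destruct (Hu n) as [H1 [_ H3]].
    pose proof (d_triangle Hd Hp H1 Hx) as Ht. rewrite (d_sym Hd H1 Hx) in Ht.
    assert (I <= d p z ^ 2) by (apply HI1; exists z; auto).
    pose proof (d_nonneg Hd Hp Hz).
    assert (d p z + e <= d p (u n)) by (unfold e in *; lra).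
    nra.
Qed.

(** The nearest point for [t] competes for [s]; at equal distance it is itself nearest for [s], and
    uniqueness applies. The equality clause later excludes cycles in the matching. *)
Lemma nearest_mono s t y z : (forall v, s v -> K (fun w => w = v)) ->
  (forall v, s v -> t v) -> nearest p s y -> nearest p t z ->
  d p y <= d p z /\ (d p y = d p z -> y = z).
Proof.
  intros Hsv Hst Hy [Hz [Bz Hzmin]].
  assert (Bz' : in_balls s z) by (intros v Hv; apply Bz, Hst, Hv).
  split; [apply Hy; assumption|]. intro E. apply (nearest_unique Hsv Hy).
  split; [exact Hz|split; [exact Bz'|]]. intros x Hx Bx. rewrite <- E. apply Hy; assumption.
Qed.

Lemma nearest_add s y v : nearest p s y -> d (vertex v) y ^ 2 <= 1 / 2 -> nearest p (add s v) y.
Proof.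
  intros [Hy [By Hmin]] Hv. split; [exact Hy|split].
  - intros w [Hw| ->]; [apply By, Hw|exact Hv].
  - intros z Hz Bz. apply Hmin; [exact Hz|]. intros w Hw; apply Bz; left; exact Hw.
Qed.

(** [y'] comes from [z] by taking the midpoint with [y] repeatedly, so [t] is a power of 1/2.
    Dropping the negative term of the midpoint inequality leaves the convexity of squared
    distances. *)
Lemma move_towards y z e : is_point K y -> is_point K z -> 0 < e ->
  exists t y', 0 < t <= 1 /\ t < e /\ is_point K y' /\
    forall r, is_point K r -> d r y' ^ 2 <= d r y ^ 2 + t * (d r z ^ 2 - d r y ^ 2).
Proof.
  intros Hy Hz He.
  assert (Hk : forall k, exists y', is_point K y' /\ forall r, is_point K r ->
    d r y' ^ 2 <= d r y ^ 2 + (1 / 2) ^ k * (d r z ^ 2 - d r y ^ 2)).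
  { induction k as [|k [y1 [H1 IH]]].
    - exists z. split; [exact Hz|]. intros r _. rewrite pow_O; lra.
    - destruct (Hmid Hy H1) as [m [Hm Hle]]. exists m. split; [exact Hm|].
      intros r Hr. specialize (IH r Hr). specialize (Hle r Hr).
      pose proof (pow2_ge_0 (d y y1)). rewrite <- (tech_pow_Rmult (1 / 2) k). lra. }
  destruct (pow_lt_1_zero (1 / 2)) with (y := e) as [N HN]; [rewrite Rabs_right; lra|lra|].
  specialize (HN N (le_n N)). destruct (Hk N) as [y' [Hy' Hle]].
  assert (0 < (1 / 2) ^ N) by (apply pow_lt; lra).
  rewrite Rabs_right in HN by lra.
  assert ((1 / 2) ^ N <= 1 ^ N) by (apply pow_incr; lra). rewrite pow1 in *.
  exists ((1 / 2) ^ N), y'. auto.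
Qed.

(* A point strictly inside the ball of [v] can be moved a little towards any
   closer point of the remaining balls without leaving that ball. *)
Lemma nearest_del s y v : (forall w, s w -> K (fun u => u = w)) -> K (fun u => u = v) ->
  nearest p s y -> d (vertex v) y ^ 2 < 1 / 2 -> nearest p (del s v) y.
Proof.
  intros Hsv HvK [Hy [By Hmin]] Hv. split; [exact Hy|split].
  { intros w [Hw _]; apply By, Hw. }
  intros z Hz Bz. destruct (Rle_dec (d p y) (d p z)) as [h|h]; [exact h|exfalso].
  set (D := d (vertex v) y ^ 2) in *. set (M := d (vertex v) z ^ 2).
  assert (HM : 0 <= M) by apply pow2_ge_0.
  (* This bound on [t] gives t M < 1/2 - D, so the point stays in the ball of [v]; the added 1 keeps
     the denominator positive. *)
  destruct (@move_towards y z ((1 / 2 - D) / (M + 1))) as [t [y' [Ht [Hte [Hy' Hle]]]]]; auto.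
  { apply Rdiv_lt_0_compat; lra. }
  assert (By' : in_balls s y').
  { intros w Hw. specialize (Hle (vertex w) (vertex_point _ HK (Hsv w Hw))).
    destruct (classic (w = v)) as [->|Hne].
    - fold D M in Hle.
      assert (t * (M + 1) < 1 / 2 - D).
      { apply Rmult_lt_compat_r with (r := M + 1) in Hte; [|lra].
        unfold Rdiv in Hte at 1. rewrite Rmult_assoc, Rinv_l in Hte; lra. }
      assert (0 <= D) by apply pow2_ge_0. nra.
    - specialize (By w Hw). specialize (Bz w (conj Hw Hne)). nra. }
  specialize (Hmin y' Hy' By'). specialize (Hle p Hp).
  pose proof (d_nonneg Hd Hp Hy). pose proof (d_nonneg Hd Hp Hz).
  assert (d p z ^ 2 < d p y ^ 2) by nra.
  assert (d p y ^ 2 <= d p y' ^ 2) by (apply pow_incr; lra).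
  nra.
Qed.

(** Induction over balls of radius k e: a point of the next ball is within e of a point of the
    previous one and shares a vertex with it, so its support lies in the stars of finitely many
    vertices. *)
Lemma bounded_support : locally_finite K -> geodesic_space K d ->
  forall r, exists W, forall x, is_point K x -> d p x <= r -> forall v, x v <> 0 -> In v W.
Proof.
  intros HL Hg.
  set (star := fun v => proj1_sig (constructive_indefinite_description _ (locally_finite_star HL v))).
  assert (Hstar : forall v s, K s -> s v -> forall w, s w -> In w (star v)).
  { intro v. unfold star. destruct (constructive_indefinite_description _ _); assumption. }
  destruct HK as [_ [_ [_ [n0 Hdim]]]].
  (* The dimension bound makes the largest coordinate at least 1/n. A move of length at most e =
     1/(2n) changes a coordinate by at most sqrt 2 times e, which is less. The successor ensures n >
     0. *)
  set (n := INR (S n0)). assert (Hn : 0 < n) by (apply lt_0_INR; lia).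
  set (e := / (2 * n)). assert (He : 0 < e) by (apply Rinv_0_lt_compat; lra).
  assert (Hstep : forall x x', is_point K x -> is_point K x' -> d x' x <= e ->
    exists w, x' w <> 0 /\ x w <> 0).
  { intros x x' Hx Hx' Hdx.
    destruct (point_support Hx') as [l [Hl Hs]].
    destruct (point_max_coord Hx' Hl (fun v => proj1 (Hs v))) as [w [Hw Hmax]].
    assert (Hlen : (length l <= n0)%nat).
    { apply (Hdim (fun v => x' v <> 0)); [apply Hx'|exact Hl|]. intros v Hv; apply Hs, Hv. }
    assert (Hsum : lsum x' l <= INR (length l) * x' w).
    { rewrite <- lsum_const. apply lsum_le. intros; apply Hmax. }
    rewrite (point_sum Hx' Hl (fun v => proj1 (Hs v))) in Hsum.
    assert (HlR : INR (length l) <= n) by (apply le_INR; lia).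
    exists w. apply Hs in Hw. split; [exact Hw|]. intro E.
    pose proof (d_coord Hd w Hx' Hx) as Hc. rewrite E in Hc.
    pose proof (d_nonneg Hd Hx' Hx).
    assert (Hxw : 0 <= x' w) by (apply Hx').
    assert (1 <= n * x' w) by nra.
    assert (Hne : n * e = 1 / 2) by (unfold e; field; lra).
    assert (n * d x' x <= 1 / 2) by nra.
    assert (x' w ^ 2 <= 2 * d x' x ^ 2) by (replace (x' w) with (x' w - 0) by ring; exact Hc).
    assert ((n * x' w) ^ 2 <= 2 * (n * d x' x) ^ 2).
    { rewrite !Rpow_mult_distr. pose proof (pow2_ge_0 n). nra. }
    assert (0 <= n * d x' x) by nra.
    nra. }
  assert (Hk : forall k, exists W, forall x, is_point K x -> d p x <= INR k * e ->
    forall v, x v <> 0 -> In v W).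
  { induction k as [|k [W IH]].
    - destruct (point_support Hp) as [l [_ Hs]]. exists l. intros x Hx Hle v Hv.
      simpl in Hle. pose proof (d_nonneg Hd Hp Hx).
      rewrite <- (d_eq0 Hd Hp Hx) in Hv by lra. apply Hs, Hv.
    - exists (flat_map star W). intros x Hx Hle v Hv. rewrite S_INR in Hle.
      assert (Hke : 0 <= INR k * e) by (pose proof (pos_INR k); nra).
      assert (exists x', is_point K x' /\ d p x' <= INR k * e /\ d x' x <= e)
        as [x' [Hx' [H1 H2]]].
      { destruct (Rle_dec (d p x) (INR k * e)) as [h|h].
        - exists x. rewrite (d_refl Hd Hx). repeat split; try apply Hx; lra.
        - destruct (Hg p x Hp Hx) as [c [Hc0 [Hc1 Hc]]].
          (* The point at distance k e from [p] on the geodesic to [x]. *)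
          exists (c (INR k * e)).
          destruct (Hc 0 (INR k * e)) as [_ Ha]; [lra|lra|].
          destruct (Hc (INR k * e) (d p x)) as [Hpt Hb]; [lra|lra|].
          rewrite Hc0, Rabs_left1 in Ha by lra. rewrite Hc1, Rabs_left1 in Hb by lra.
          split; [exact Hpt|lra]. }
      destruct (Hstep x x' Hx Hx' H2) as [w [Hw1 Hw2]].
      apply in_flat_map. exists w. split; [exact (IH x' Hx' H1 w Hw1)|].
      apply (Hstar w (fun v => x v <> 0)); [apply Hx|exact Hw2|exact Hv]. }
  intro r. destruct (INR_unbounded (r / e)) as [k Hkr].
  destruct (Hk k) as [W HW]. exists W. intros x Hx Hle. apply HW; [exact Hx|].
  assert (r / e * e = r) by (field; lra). nra.
Qed.
End Balls.

(** * Collapsing along a matching *)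

Lemma exists_maximal (A : Type) (lt : A -> A -> Prop) (l : list A) :
  (forall a, ~ lt a a) -> (forall a b c, lt a b -> lt b c -> lt a c) -> l <> nil ->
  exists a, In a l /\ forall b, In b l -> ~ lt a b.
Proof.
  intros Hirr Htr. induction l as [|a l IH]; intro H; [congruence|].
  destruct (classic (exists b, In b l /\ lt a b)) as [[b [Hb Hab]]|Hno].
  - destruct IH as [m [Hm Hmax]]; [intros ->; destruct Hb|].
    exists m. split; [right; exact Hm|]. intros c [->|Hc] Hmc.
    + exact (Hmax b Hb (Htr _ _ _ Hmc Hab)).
    + exact (Hmax c Hc Hmc).
  - exists a. split; [left; reflexivity|]. intros c [->|Hc] Hac.
    + exact (Hirr _ Hac).
    + apply Hno. exists c; split; assumption.
Qed.

Fixpoint sublists (A : Type) (l : list A) : list (list A) :=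
  match l with
  | nil => nil :: nil
  | a :: l' => sublists l' ++ map (cons a) (sublists l')
  end.

Lemma sublists_spec (A : Type) (l : list A) (s : vset A) :
  (forall v, s v -> In v l) -> exists l', In l' (sublists l) /\ same s (fun w => In w l').
Proof.
  revert s. induction l as [|a l IH]; intros s Hs.
  - exists nil. split; [left; reflexivity|]. intro v; split; [apply Hs|intros []].
  - destruct (IH (fun v => s v /\ In v l)) as [l' [Hl' Hsame]]; [tauto|].
    destruct (classic (s a)) as [Ha|Ha].
    + exists (a :: l'). split; [apply in_or_app; right; apply in_map, Hl'|].
      intro v. simpl. specialize (Hsame v); cbv beta in Hsame. rewrite <- Hsame. split.
      * intro Hv. destruct (Hs v Hv) as [E|Hin]; [left; exact E|right; split; assumption].
      * intros [<-|[Hv _]]; assumption.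
    + exists l'. split; [apply in_or_app; left; exact Hl'|].
      intro v. specialize (Hsame v); cbv beta in Hsame. rewrite <- Hsame. split; [|tauto].
      intro Hv. split; [exact Hv|]. destruct (Hs v Hv) as [<-|Hin]; [contradiction|exact Hin].
Qed.

Lemma sublists_filter (A : Type) (P : vset A -> Prop) (W : list A) :
  (forall s, P s -> forall v, s v -> In v W) ->
  exists ls, forall s, P s <-> exists l, In l ls /\ same s (fun w => In w l).
Proof.
  intro HW.
  exists (filter (fun l => if excluded_middle_informative (P (fun w => In w l)) then true else false)
            (sublists W)).
  intro s. split.
  - intro Hs. destruct (sublists_spec W s (HW s Hs)) as [l [Hl Hsame]].
    exists l. split; [|exact Hsame]. apply filter_In. split; [exact Hl|].
    rewrite <- (same_eq Hsame). destruct (excluded_middle_informative (P s)); [reflexivity|contradiction].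
  - intros [l [Hl Hsame]]. apply filter_In in Hl. destruct Hl as [_ Hl].
    rewrite (same_eq Hsame). destruct (excluded_middle_informative _); [assumption|discriminate].
Qed.

Section Matching.
(** Abstract form of the matching: [g] will be the distance from [v0] to the nearest point and [c s]
    the vertex toggled in [s]. A toggle preserves [c], so a second one undoes it. The simplex {v0}
    stays unmatched, as deleting [v0] would empty it. [g_mono] supplies acyclicity: where [g] is
    constant along a face relation, the toggled vertex is the same. *)
Variables (V : Type) (K : complex V) (g : vset V -> R) (c : vset V -> V) (v0 : V).
Hypothesis K_nonempty : forall s, K s -> exists v, s v.
Hypothesis K_v0 : K (fun w => w = v0).
Hypothesis c_v0 : c (fun w => w = v0) = v0.
Hypothesis toggle_add : forall s, K s ->
  K (add s (c s)) /\ g (add s (c s)) = g s /\ c (add s (c s)) = c s.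
Hypothesis toggle_del : forall s, K s -> s (c s) -> s <> (fun w => w = v0) ->
  K (del s (c s)) /\ g (del s (c s)) = g s /\ c (del s (c s)) = c s.
Hypothesis g_mono : forall s t, K s -> K t -> face s t ->
  g s <= g t /\ (g s = g t -> c s = c t).

Lemma add_del (s : vset V) (v : V) : s v -> add (del s v) v = s.
Proof.
  intro Hv. apply same_eq. intro w. unfold add, del. split.
  - intros [[H _]| ->]; assumption.
  - intro Hw. destruct (classic (w = v)); tauto.
Qed.

Lemma del_add (s : vset V) (v : V) : ~ s v -> del (add s v) v = s.
Proof.
  intro Hv. apply same_eq. intro w. unfold add, del. split; [tauto|].
  intro Hw. split; [tauto|]. intros ->; contradiction.
Qed.

(** Ensures that {v0} is never the upper member of a removed pair. *)
Lemma add_v0 (s : vset V) : K s -> ~ s (c s) -> add s (c s) <> (fun w => w = v0).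
Proof.
  intros Hs Hc E. destruct (K_nonempty Hs) as [w Hw].
  assert (H1 : w = v0) by (change ((fun u => u = v0) w); rewrite <- E; left; exact Hw).
  assert (H2 : c s = v0) by (change ((fun u => u = v0) (c s)); rewrite <- E; right; reflexivity).
  apply Hc. rewrite H2, <- H1. exact Hw.
Qed.

(** The invariant of the collapsing induction; it survives the removal of a matched pair. *)
Definition toggle_closed (ls : list (vset V)) : Prop := forall s, In s ls ->
  (~ s (c s) -> In (add s (c s)) ls) /\
  (s (c s) -> s <> (fun w => w = v0) -> In (del s (c s)) ls).

(* Among the lower members of the matched pairs take one with maximal [g], and
   then maximal for inclusion: it is a free face of its partner. *)
Lemma matching_collapsible (ls : list (vset V)) :
  (forall s, In s ls -> K s) -> In (fun w => w = v0) ls -> toggle_closed ls ->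
  collapsible (fun s => In s ls).
Proof.
  remember (length ls) as n eqn:Hn. assert (Hle : (length ls <= n)%nat) by lia. clear Hn.
  revert ls Hle. induction n as [|n IH]; intros ls Hlen HlsK Hv0 Htc.
  { destruct ls; [destruct Hv0|simpl in Hlen; lia]. }
  set (low := filter (fun s => if excluded_middle_informative (s (c s)) then false else true) ls).
  assert (Hlow : forall s, In s low <-> In s ls /\ ~ s (c s)).
  { intro s. unfold low. rewrite filter_In.
    destruct (excluded_middle_informative (s (c s))); split; intros [H1 H2]; split;
      first [assumption|reflexivity|discriminate|contradiction]. }
  (* Without lower members only {v0} is left, since any other simplex is a lower member or has one
     as its partner. *)
  destruct (classic (low = nil)) as [Hnil|Hnil].
  { apply coll_vertex with v0. intro s. split.
    - intro Hs. destruct (classic (s = (fun w => w = v0))) as [->|Hne]; [intro; reflexivity|].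
      exfalso. destruct (classic (s (c s))) as [Hc|Hc].
      + assert (Hin : In (del s (c s)) low); [|rewrite Hnil in Hin; destruct Hin].
        apply Hlow. split; [apply (proj2 (Htc s Hs)); assumption|].
        destruct (toggle_del (HlsK s Hs) Hc Hne) as [_ [_ ->]]. intros [_ H]; congruence.
      + assert (Hin : In s low) by (apply Hlow; split; assumption).
        rewrite Hnil in Hin; destruct Hin.
    - intro Hs. rewrite (same_eq Hs). exact Hv0. }
  destruct (exists_maximal
    (fun s t => g s < g t \/ (g s = g t /\ proper_face s t)) (l := low)) as [s [Hs Hmax]].
  { intros a [H|[_ [_ [v [H1 H2]]]]]; [lra|contradiction]. }
  { intros a b e [H|[H [Ha [v [Hv1 Hv2]]]]] [H'|[H' [Hb [v' [Hv1' Hv2']]]]]; try (left; lra).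
    right. split; [lra|]. split; [intros w Hw; apply Hb, Ha, Hw|].
    exists v. split; [apply Hb, Hv1|exact Hv2]. }
  { exact Hnil. }
  apply Hlow in Hs. destruct Hs as [Hs Hcs].
  pose proof (HlsK s Hs) as HsK.
  destruct (toggle_add HsK) as [HtK [Htg Htcc]].
  pose proof (proj1 (Htc s Hs) Hcs) as Ht.
  set (v := c s) in *. set (t := add s v) in *.
  assert (Htv : t v) by (right; reflexivity).
  assert (Hsv0 : s <> (fun w => w = v0)).
  { intros E. apply Hcs. unfold v. rewrite E, c_v0. reflexivity. }
  assert (Htv0 : t <> (fun w => w = v0)) by (apply add_v0; assumption).
  (* A lower [r] above [s] contradicts the choice of [s]. For an upper [r], its lower partner has
     the same [g], so maximality gives g r = g s and [g_mono] gives c r = v; then [del r v] contains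
     [s], and maximality for inclusion makes them equal. *)
  assert (Hlift : forall r, In r ls -> proper_face s r -> r = t).
  { intros r Hr [Hsr [w [Hw1 Hw2]]]. pose proof (HlsK r Hr) as HrK.
    destruct (g_mono HsK HrK Hsr) as [Hg1 Hg2].
    assert (Hrv0 : r <> (fun u => u = v0)).
    { intros E. destruct (K_nonempty HsK) as [u Hu].
      assert (u = v0) by (change ((fun u => u = v0) u); rewrite <- E; apply Hsr, Hu).
      assert (w = v0) by (change ((fun u => u = v0) w); rewrite <- E; exact Hw1).
      subst. contradiction. }
    destruct (classic (r (c r))) as [Hc|Hc].
    - destruct (toggle_del HrK Hc Hrv0) as [_ [Hg3 Hc3]].
      assert (Hin : In (del r (c r)) low).
      { apply Hlow. split; [apply (proj2 (Htc r Hr)); assumption|].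
        rewrite Hc3. intros [_ H]; congruence. }
      specialize (Hmax _ Hin).
      assert (Hgeq : g s = g r).
      { destruct (Rle_lt_or_eq_dec _ _ Hg1) as [H|H]; [|exact H].
        exfalso; apply Hmax; left; rewrite Hg3; exact H. }
      assert (Hcv : c r = v) by (symmetry; apply Hg2, Hgeq).
      rewrite Hcv in *.
      assert (E : del r v = s).
      { apply same_eq. intro u. split.
        - intro Hu. apply NNPP; intro Hnu. apply Hmax. right. split; [congruence|].
          split; [|exists u; split; assumption].
          intros u' Hu'. split; [apply Hsr, Hu'|]. intros ->; contradiction.
        - intro Hu. split; [apply Hsr, Hu|]. intros ->; contradiction. }
      unfold t. rewrite <- E. symmetry. apply add_del, Hc.
    - exfalso. assert (Hin : In r low) by (apply Hlow; split; assumption).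
      apply (Hmax r Hin). destruct (Rle_lt_or_eq_dec _ _ Hg1) as [H|H]; [left; exact H|].
      right. split; [exact H|]. split; [exact Hsr|]. exists w; split; assumption. }
  set (ls' := remove (@eq_dec_cl (vset V)) s (remove (@eq_dec_cl (vset V)) t ls)).
  assert (Hls' : forall r, In r ls' <-> In r ls /\ r <> s /\ r <> t).
  { intro r. unfold ls'. split.
    - intro H. apply in_remove in H. destruct H as [H H1]. apply in_remove in H.
      destruct H; auto.
    - intros [H1 [H2 H3]]. apply in_in_remove; [exact H2|]. apply in_in_remove; assumption. }
  apply coll_step with (L' := fun r => In r ls') (s := s) (t := t).
  - exact Hs.
  - exact Ht.
  - split; [intros w Hw; left; exact Hw|]. exists v; split; assumption.
  - intros r Hr Hsr. rewrite (Hlift r Hr Hsr). intro; reflexivity.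
  - assert (Hsame : forall r s : vset V, r <> s <-> ~ same r s).
    { intros r r'. split; intros H E; apply H; [apply same_eq, E|].
      rewrite E. intro; reflexivity. }
    intro r. rewrite Hls', !Hsame. reflexivity.
  - apply IH.
    + assert (length ls' <= length (remove (@eq_dec_cl (vset V)) t ls))%nat by apply remove_length_le.
      pose proof (remove_length_lt (@eq_dec_cl (vset V)) ls t Ht). lia.
    + intros r Hr. apply HlsK, Hls', Hr.
    + apply Hls'. auto.
    (* Toggling is an involution, so a simplex whose partner is [s] or [t] is itself [t] or [s]. *)
    + intros r Hr. apply Hls' in Hr. destruct Hr as [Hr [Hrs Hrt]].
      pose proof (HlsK r Hr) as HrK. split.
      * intro Hc. apply Hls'. split; [apply (proj1 (Htc r Hr)), Hc|].
        destruct (toggle_add HrK) as [_ [_ Hcc]]. split; intro E.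
        -- apply Hcs. unfold v. rewrite <- E, Hcc. right; reflexivity.
        -- apply Hrs. rewrite <- (del_add _ _ Hcs), <- (del_add _ _ Hc).
           change (add s v) with t. f_equal; [exact E|]. rewrite <- Hcc, E. exact Htcc.
      * intros Hc Hne. apply Hls'. split; [apply (proj2 (Htc r Hr)); assumption|].
        destruct (toggle_del HrK Hc Hne) as [_ [_ Hcc]].
        assert (Hncr : ~ del r (c r) (c r)) by (intros [_ H]; congruence).
        split; intro E.
        -- apply Hrt. rewrite <- (add_del _ _ Hc). unfold t. rewrite E. f_equal.
           unfold v. rewrite <- E. symmetry; exact Hcc.
        -- apply Hncr. rewrite E, <- Hcc, E, Htcc. exact Htv.
Qed.

(** The sublevel sets of [g] at the natural numbers work: [g_mono] closes them under faces, toggles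
    preserve [g], and the bound on [g] at {v0} puts that vertex even in the set of index 0. *)
Lemma matching_exhaustion : is_complex K ->
  (forall r, exists W, forall s, K s -> g s <= r -> forall v, s v -> In v W) ->
  g (fun w => w = v0) <= 0 ->
  exists L : nat -> complex V,
    (forall n, subcomplex (L n) K /\ finite_complex (L n) /\ collapsible (L n)) /\
    (forall n s, L n s -> L (S n) s) /\
    (forall s, K s <-> exists n, L n s).
Proof.
  intros HK Hfin Hg0.
  exists (fun n s => K s /\ g s <= INR n). split; [|split].
  - intro n. destruct (Hfin (INR n)) as [W HW].
    destruct (sublists_filter (fun s => K s /\ g s <= INR n) W) as [ls Hls].
    { intros s [Hs Hg]. exact (HW s Hs Hg). }
    split; [|split].
    + split; [|tauto]. destruct HK as [H1 [H2 [H3 [m H4]]]].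
      split; [intros s [Hs _]; apply H1, Hs|split; [|split]].
      * intros s t [Hs Hg] E. rewrite <- (same_eq E). split; assumption.
      * intros s t [Hs Hg] Hts Ht. assert (HtK : K t) by (apply (H3 s t); assumption).
        split; [exact HtK|]. destruct (g_mono HtK Hs Hts) as [Hle _]. lra.
      * exists m. intros s [Hs _]. exact (H4 s Hs).
    + exists ls. exact Hls.
    + set (ls' := map (fun l => (fun w => In w l) : vset V) ls).
      assert (Hls' : forall s, In s ls' <-> K s /\ g s <= INR n).
      { intro s. rewrite (Hls s). unfold ls'. rewrite in_map_iff. split.
        - intros [l [<- Hl]]. exists l. split; [exact Hl|intro; reflexivity].
        - intros [l [Hl E]]. exists l. split; [symmetry; apply same_eq, E|exact Hl]. }
      replace (fun s => K s /\ g s <= INR n) with (fun s => In s ls').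
      2:{ apply functional_extensionality; intro s. apply propositional_extensionality, Hls'. }
      apply matching_collapsible.
      * intros s Hs. apply Hls', Hs.
      * apply Hls'. split; [exact K_v0|]. pose proof (pos_INR n). lra.
      * intros s Hs. apply Hls' in Hs. destruct Hs as [Hs Hg]. split.
        -- intros _. apply Hls'. destruct (toggle_add Hs) as [H1 [-> _]]. split; assumption.
        -- intros Hc Hne. apply Hls'. destruct (toggle_del Hs Hc Hne) as [H1 [-> _]].
           split; assumption.
  - intros n s [Hs Hg]. split; [exact Hs|]. rewrite S_INR. lra.
  - intro s. split.
    + intro Hs. destruct (INR_unbounded (g s)) as [n Hn]. exists n. split; [exact Hs|lra].
    + intros [n [Hs _]]; exact Hs.
Qed.
End Matching.

(** * The matching defined by nearest points *)

Theorem theorem2p3 (V : Type) (K : complex V) :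
  is_complex K -> (exists s, K s) -> locally_finite K -> is_CAT0_complex K ->
  exists L : nat -> complex V,
    (forall n, subcomplex (L n) K /\ finite_complex (L n) /\ collapsible (L n)) /\
    (forall n s, L n s -> L (S n) s) /\
    (forall s, K s <-> exists n, L n s).
Proof.
  intros HK [s0 Hs0] HL [d [Hd [Hg HC]]].
  pose proof (CAT0_midpoint_ineq Hd Hg HC) as Hmid.
  destruct (proj1 HK s0 Hs0) as [_ [v0 Hv0]].
  assert (Kv0 : K (fun w => w = v0)) by exact (complex_vertex _ v0 HK Hs0 Hv0).
  set (p := vertex v0).
  assert (Hp : is_point K p) by (apply vertex_point; assumption).
  assert (Kvert : forall s, K s -> forall v, s v -> K (fun w => w = v)).
  { intros s Hs v Hv. exact (complex_vertex s v HK Hs Hv). }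
  set (m := fun s => epsilon (inhabits p) (nearest K d p s)).
  assert (Hm : forall s, K s -> nearest K d p s (m s)).
  { intros s Hs. apply epsilon_spec. apply (nearest_exists HK Hd Hmid Hp _ HL Hs). }
  assert (Hm_eq : forall s y, K s -> nearest K d p s y -> m s = y).
  { intros s y Hs Hy. apply (nearest_unique HK Hd Hmid Hp (Kvert s Hs) (Hm s Hs) Hy). }
  (* The choice depends on the point alone, so simplices with the same nearest point toggle the same
     vertex. *)
  set (top := fun y : V -> R =>
    epsilon (inhabits v0) (fun v => y v <> 0 /\ d (vertex v) y ^ 2 < 1 / 2)).
  assert (Htop : forall y, is_point K y ->
    y (top y) <> 0 /\ d (vertex (top y)) y ^ 2 < 1 / 2).
  { intros y Hy. unfold top. apply epsilon_spec. apply (near_vertex HK Hd Hy). }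
  assert (Hmv0 : m (fun w => w = v0) = p).
  { apply Hm_eq; [exact Kv0|]. split; [exact Hp|split].
    - intros v ->. fold p. rewrite (d_refl Hd Hp). lra.
    - intros z Hz _. rewrite (d_refl Hd Hp). apply (d_nonneg Hd); assumption. }
  assert (Htopp : top p = v0) by (apply vertex_neq0, Htop, Hp).
  apply matching_exhaustion with (g := fun s => d p (m s)) (c := fun s => top (m s)) (v0 := v0).
  - intros s Hs. apply (proj1 HK s Hs).
  - exact Kv0.
  - rewrite Hmv0. exact Htopp.
  - intros s Hs. destruct (Hm s Hs) as [Hy [By _]]. destruct (Htop _ Hy) as [Ht1 Ht2].
    assert (Ka : K (add s (top (m s)))).
    { apply (@complex_face V K (fun v => m s v <> 0) _ (top (m s)) HK).
      - apply Hy.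
      - intros w [Hw| ->]; [|exact Ht1].
        apply (d_vertex_lower HK Hd _ (Kvert s Hs w Hw) Hy). apply By, Hw.
      - right; reflexivity. }
    assert (E : m (add s (top (m s))) = m s).
    { apply Hm_eq; [exact Ka|]. apply nearest_add; [apply Hm, Hs|lra]. }
    rewrite E. auto.
  - intros s Hs Hc Hne. pose proof (Hm s Hs) as Hn. destruct Hn as [Hy [By _]].
    destruct (Htop _ Hy) as [Ht1 Ht2].
    assert (Hdel : nearest K d p (del s (top (m s))) (m s)).
    { apply (nearest_del HK Hd Hmid Hp _ (Kvert s Hs)); auto. exact (Kvert s Hs _ Hc). }
    (* If nothing were left, [m s] would be nearest to [p] among all points, hence equal to [p]; the
       toggled vertex would be [v0] and [s] would be the excluded {v0}. *)
    assert (exists w, del s (top (m s)) w) as [w Hw].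
    { apply NNPP; intro Hno. apply Hne.
      assert (Hpm : p = m s).
      { apply (d_eq0 Hd Hp Hy). apply Rle_antisym; [|apply (d_nonneg Hd); assumption].
        rewrite <- (d_refl Hd Hp). apply Hdel; [exact Hp|].
        intros v Hv. exfalso; apply Hno; exists v; exact Hv. }
      rewrite <- Hpm, Htopp in *. apply same_eq. intro v. split; [|intros ->; exact Hc].
      intro Hv. apply NNPP; intro Hv'. apply Hno. exists v; split; assumption. }
    assert (Kd : K (del s (top (m s)))).
    { apply (@complex_face V K s _ w HK Hs); [intros u [Hu _]; exact Hu|exact Hw]. }
    rewrite (Hm_eq _ _ Kd Hdel). auto.
  - intros s t Hs Ht Hst.
    destruct (nearest_mono HK Hd Hmid Hp (Kvert s Hs) Hst (Hm s Hs) (Hm t Ht)) as [H1 H2].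
    split; [exact H1|]. intro E. f_equal. exact (H2 E).
  - exact HK.
  (* [s] lies in the support of [m s], and a bound on [g s] keeps [m s] in a bounded set. *)
  - intro r. destruct (bounded_support HK Hd Hp HL Hg r) as [W HW]. exists W.
    intros s Hs Hr v Hv. destruct (Hm s Hs) as [Hy [By _]].
    apply (HW (m s) Hy Hr). apply (d_vertex_lower HK Hd _ (Kvert s Hs v Hv) Hy). apply By, Hv.
  - rewrite Hmv0, (d_refl Hd Hp). lra.
Qed.
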